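(* Let $N\ge1$, $s>0$, $p\in[1,\infty)$, $q\in[1,\infty)$. Then there exists $f\in L^p(\mathbb{R}^N)$ satisfying \[\sup_{0<r<s}(s-r)^{1/q}\|f\|_{\mathbf{B}^r_{p,q}(\mathbb{R}^N)}<\infty\] but $f\notin B^s_{p,\infty}(\mathbb{R}^N)$.
   Context: Subatomic (quarkonial) norm: fix a nonnegative $\psi\in C^\infty_c(\mathbb{R}^N)$ with $\mathrm{supp}\,\psi\subset B_{2^{r_0}}$ for some $r_0\ge0$ and $\sum_{k\in\mathbb{Z}^N}\psi(x-k)=1$ for all $x$, and fix $\varrho>r_0$. For $\beta\in\mathbb{N}^N$ let $\psi^\beta(x)=x^\beta\psi(x)$. For $r>0$, $p\in[1,\infty]$, $\nu\in\mathbb{N}$, $m\in\mathbb{Z}^N$, the $(r,p)$-$\beta$-quark is $(\beta\mathrm{qu})_{\nu,m}(x)=2^{-\nu(r-N/p)}\psi^\beta(2^\nu x-m)$. For coefficients $\lambda=(\lambda^\beta_{\nu,m})$ set $\|\lambda\|_{\varrho,p,q}=\sup_\beta 2^{\varrho|\beta|}\big(\sum_{\nu\ge0}(\sum_m|\lambda^\beta_{\nu,m}|^p)^{q/p}\big)^{1/q}$. Then $\|f\|_{\mathbf{B}^r_{p,q}}$ is the infimum of $\|\lambda\|_{\varrho,p,q}$ over all representations $f=\sum_\beta\sum_{\nu\ge0}\sum_m\lambda^\beta_{\nu,m}(\beta\mathrm{qu})_{\nu,m}$ in $\mathscr{S}'(\mathbb{R}^N)$ (using $(r,p)$-quarks).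 $B^s_{p,\infty}(\mathbb{R}^N)$ is the set of $f\in L^p$ with $\sup_{h\ne0}|h|^{-s}\|\Delta^M_hf\|_{L^p}<\infty$ for an integer $M>s$, where $\Delta_h^Mf(x)=\sum_{j=0}^M(-1)^{M-j}\binom Mj f(x+jh)$. *)

(* Defs.v *)
From HB Require Import structures.
From mathcomp Require Import all_boot all_order all_algebra.
From mathcomp Require Import all_classical all_reals all_analysis.
Set Implicit Arguments. Unset Strict Implicit. Unset Printing Implicit Defensive.
Import Order.TTheory GRing.Theory Num.Theory.
Import numFieldNormedType.Exports.
Local Open Scope classical_set_scope.
Local Open Scope ring_scope.

Section QuarkDefs.
Variables (R : realType) (N : nat).
Local Notation RN := ('rV[R]_N).

Definition enorm (x : RN) : R := Num.sqrt (\sum_(i < N) (x ord0 i) ^+ 2).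

Definition monom (x : RN) (b : 'rV[nat]_N) : R := \prod_(i < N) (x ord0 i) ^+ (b ord0 i).
Definition mlen (b : 'rV[nat]_N) : nat := (\sum_(i < N) b ord0 i)%N.

Definition unitv (k : 'I_N) : RN := delta_mx 0 k.
Fixpoint iter_partial (ks : seq 'I_N) (g : RN -> R) : RN -> R :=
  match ks with
  | [::] => g
  | k :: ks' => fun x => 'D_(unitv k) (iter_partial ks' g) x
  end.

Definition smooth (g : RN -> R) : Prop :=
  forall (ks : seq 'I_N) (x : RN), differentiable (iter_partial ks g) x.

Definition schwartz (g : RN -> R) : Prop :=
  smooth g /\ forall (a : 'rV[nat]_N) (ks : seq 'I_N),
    exists C : R, forall x, `|monom x a * iter_partial ks g x| <= C.

Definition borel_RN (g : RN -> R) : Prop :=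
  forall B : set R, measurable B -> <<s [set U : set RN | open U] >> (g @^-1` B).

Fixpoint iint (n : nat) : ('rV[R]_n -> \bar R) -> \bar R :=
  match n with
  | 0%N => fun g => g 0
  | n'.+1 => fun g =>
      (\int[@lebesgue_measure R]_(t in [set: R]) iint (fun y : 'rV[R]_n' =>
          g (row_mx (const_mx t : 'rV[R]_1) y)))%E
  end.

Definition integralRN (g : RN -> R) : \bar R :=
  (iint (fun x => (Num.max (g x) 0)%:E) - iint (fun x => (Num.max (- g x) 0)%:E))%E.

Definition Lpnorm (p : R) (g : RN -> R) : \bar R :=
  poweR (iint (fun x => (`|g x| `^ p)%:E)) p^-1.

Definition inLp (p : R) (g : RN -> R) : Prop :=
  borel_RN g /\ (iint (fun x => (`|g x| `^ p)%:E) < +oo)%E.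

Definition diffM (M : nat) (h : RN) (g : RN -> R) (x : RN) : R :=
  \sum_(j < M.+1) (- 1) ^+ (M - j) * 'C(M, j)%:R * g (x + j%:R *: h).

Definition inBinf (s p : R) (g : RN -> R) : Prop :=
  inLp p g /\ exists M : nat, s < M%:R /\
   (ereal_sup [set ((enorm h) `^ (- s))%:E * Lpnorm p (diffM M h g) | h in [set h : RN | h != 0%R]]
     < +oo)%E.

Definition psi_ok (psi : RN -> R) (r0 : R) : Prop :=
  (forall x, 0 <= psi x) /\ smooth psi /\
  closure [set x | psi x != 0] `<=` [set x | enorm x < 2 `^ r0] /\
  (forall x, (\esum_(k in [set: 'rV[int]_N]) (psi (x - map_mx (fun z : int => z%:~R) k))%:E = 1)%E).

Definition quark (psi : RN -> R) (r p : R) (b : 'rV[nat]_N) (nu : nat) (m : 'rV[int]_N)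
  (x : RN) : R :=
  let y := 2 ^+ nu *: x - map_mx (fun z : int => z%:~R) m in
  2 `^ (- (nu%:R * (r - N%:R / p))) * (monom y b * psi y).

Definition coefs := 'rV[nat]_N -> nat -> 'rV[int]_N -> R.

Definition coef_norm (rho p q : R) (lam : coefs) : \bar R :=
  ereal_sup [set ((2 `^ (rho * (mlen b)%:R))%:E *
     poweR (\esum_(nu in [set: nat])
              poweR (\esum_(m in [set: 'rV[int]_N]) (`|lam b nu m| `^ p)%:E) (q / p)) q^-1)%E
    | b in [set: 'rV[nat]_N]].

(* lam represents g in S'(R^N): for every Schwartz phi the family of pairings
   is absolutely summable and sums to <g, phi> *)
Definition represents (psi : RN -> R) (r p : R) (lam : coefs) (g : RN -> R) : Prop :=
  forall phi : RN -> R, schwartz phi ->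
    let a := fun i : ('rV[nat]_N * nat * 'rV[int]_N) =>
      lam i.1.1 i.1.2 i.2 * fine (integralRN (fun x => quark psi r p i.1.1 i.1.2 i.2 x * phi x)) in
    (\esum_(i in [set: 'rV[nat]_N * nat * 'rV[int]_N]) (`|a i|)%:E < +oo)%E /\
    (\esum_(i in [set: 'rV[nat]_N * nat * 'rV[int]_N]) (Num.max (a i) 0)%:E
     - \esum_(i in [set: 'rV[nat]_N * nat * 'rV[int]_N]) (Num.max (- a i) 0)%:E)%E
    = integralRN (fun x => g x * phi x).

Definition besov_qnorm (psi : RN -> R) (rho r p q : R) (g : RN -> R) : \bar R :=
  ereal_inf [set coef_norm rho p q lam | lam in [set lam | represents psi r p lam g]].

End QuarkDefs.

(* Main.v *)
Require Import Defs.
From HB Require Import structures.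
From mathcomp Require Import all_boot all_order all_algebra.
From mathcomp Require Import all_classical all_reals all_analysis.
From mathcomp Require Import measurable_realfun.
From mathcomp Require Import ring lra zify.
Import Order.TTheory GRing.Theory Num.Theory.
Import numFieldNormedType.Exports.
Local Open Scope classical_set_scope.
Local Open Scope ring_scope.

(** The function is a lacunary sum of far-apart dilated copies of [psi],
    f = sum_nu c_nu psi(2^nu (x - L nu e_1)) with
    c_nu = w_nu^(1/q) 2^(-nu (s - N/p)), where w_nu = nu when nu is a power of 2 and
    w_nu = 0 otherwise.  The partial sums of w are O(n), so
    sum_nu w_nu 2^(-nu (s-r) q) = O(1/(s-r)); this is the q-th power of the coefficient
    norm of the obvious representation of f by quarks with beta = 0.  On the other hand
    w is unbounded, and for h = 2^(-nu) L e_1 (with nu large) only one term of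
    Delta_h^M f is nonzero on the support of the nu-th piece, whence
    |h|^(-s) ||Delta_h^M f||_p is at least a constant times w_nu^(1/q). *)

(** * Iterated integrals *)

(** The integral of a nonnegative function is a supremum over the simple functions below it, and
    this set grows with the function. The comparison thus applies to finite differences whose
    measurability is never established. *)
Lemma ge0_le_integral_any {d} {T : measurableType d} {R : realType}
    (mu : {measure set T -> \bar R}) (D : set T) (f g : T -> \bar R) :
  (forall x, D x -> 0 <= f x)%E -> (forall x, D x -> f x <= g x)%E ->
  (\int[mu]_(x in D) f x <= \int[mu]_(x in D) g x)%E.
Proof.
move=> f0 fg.
have g0 x : D x -> (0 <= g x)%E by move=> Dx; exact: le_trans (f0 _ Dx) (fg _ Dx).
rewrite !ge0_integralE//; apply: le_ereal_sup => _ [h hf <-].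
exists h => // x; apply: le_trans (hf x) _; rewrite /patch.
by case: ifP => // /set_mem /fg.
Qed.

Lemma iint_ge0 {R : realType} {n} (g : 'rV[R]_n -> \bar R) :
  (forall x, 0 <= g x)%E -> (0 <= iint g)%E.
Proof.
elim: n g => [|n IH] g g0 //=.
by apply: integral_ge0 => t _; exact: IH.
Qed.

Lemma le_iint {R : realType} {n} (f g : 'rV[R]_n -> \bar R) :
  (forall x, 0 <= f x)%E -> (forall x, f x <= g x)%E -> (iint f <= iint g)%E.
Proof.
elim: n f g => [|n IH] f g f0 fg //=.
apply: ge0_le_integral_any => t _; first exact: iint_ge0.
exact: IH.
Qed.

Definition cmeas {d} {T : measurableType d} {R : realType} {n} (e : T -> 'rV[R]_n) :=
  forall i, measurable_fun [set: T] (fun t => e t ord0 i).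

(* Borel measurability on R^n, phrased through the coordinates so that it can be
   sectioned along the first variable as [iint] does. *)
Definition fdmeas {R : realType} {n} (g : 'rV[R]_n -> \bar R) :=
  forall d (T : measurableType d) (e : T -> 'rV[R]_n),
  cmeas e -> measurable_fun [set: T] (g \o e).

(** The vector that [iint] builds at each level, so that unfolding [iint] matches this term by
    conversion. *)
Definition scons {R : realType} {n} (t : R) (y : 'rV[R]_n) : 'rV[R]_n.+1 :=
  row_mx (const_mx t : 'rV[R]_1) y.

Lemma scons0 {R : realType} {n} (t : R) (y : 'rV[R]_n) : scons t y ord0 ord0 = t.
Proof.
rewrite /scons mxE; case: splitP => j /= hj; last by rewrite add1n in hj.
by rewrite mxE.
Qed.

Lemma sconsS {R : realType} {n} (t : R) (y : 'rV[R]_n) (i : 'I_n) :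
  scons t y ord0 (lift ord0 i) = y ord0 i.
Proof.
rewrite /scons mxE; case: splitP => j /=; first by rewrite [j]ord1.
by rewrite /bump /= !add1n => -[] /val_inj ->.
Qed.

Lemma cmeas_scons {d} {T : measurableType d} {R : realType} {n} (u : T -> R)
    (e : T -> 'rV[R]_n) :
  measurable_fun [set: T] u -> cmeas e -> cmeas (fun t => scons (u t) (e t)).
Proof.
move=> mu me i; have [j ->|->] := unliftP ord0 i.
  by under eq_fun do rewrite sconsS; exact: me.
by under eq_fun do rewrite scons0.
Qed.

(** Induction on the dimension: the first variable joins the parameter space, which becomes [T * R],
    and Tonelli integrates it out. Since the parameter space changes, joint measurability is tested
    against maps from every space. *)
Lemma measurable_iint {d} {T : measurableType d} {R : realType} {n}
    (F : T -> 'rV[R]_n -> \bar R) :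
  (forall t x, 0 <= F t x)%E ->
  (forall d' (T' : measurableType d') (a : T' -> T) (e : T' -> 'rV[R]_n),
     measurable_fun [set: T'] a -> cmeas e ->
     measurable_fun [set: T'] (fun t => F (a t) (e t))) ->
  measurable_fun [set: T] (fun t => iint (F t)).
Proof.
elim: n d T F => [|n IH] d T F F0 mF /=.
  by apply: (mF _ _ id (fun=> 0)) => // i; exact: measurable_cst.
pose G (z : T * measurableTypeR R) := iint (fun y => F z.1 (scons z.2 y)).
have mG : measurable_fun [set: T * measurableTypeR R] G.
  apply: (IH _ (T * measurableTypeR R)%type (fun z y => F z.1 (scons z.2 y))) => //.
  move=> d' T' a e ma me.
  apply: (mF _ _ (fun t => (a t).1) (fun t => scons (a t).2 (e t))).
    exact: measurableT_comp measurable_fst ma.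
  apply: cmeas_scons => //; exact: measurableT_comp measurable_snd ma.
have G0 z : (0 <= G z)%E by apply: iint_ge0 => y; exact: F0.
exact: (@measurable_fun_fubini_tonelli_F _ _ _ (measurableTypeR R) R
  (@lebesgue_measure R) G mG G0).
Qed.

Lemma fdmeas_scons {R : realType} {n} (g : 'rV[R]_n.+1 -> \bar R) (t : R) :
  fdmeas g -> fdmeas (fun y => g (scons t y)).
Proof.
move=> mg d T e me; apply: (mg _ _ (fun s => scons t (e s))).
by apply: cmeas_scons => //; exact: measurable_cst.
Qed.

Lemma measurable_iint_scons {R : realType} {n} (g : 'rV[R]_n.+1 -> \bar R) :
  (forall x, 0 <= g x)%E -> fdmeas g ->
  measurable_fun [set: measurableTypeR R] (fun t => iint (fun y => g (scons t y))).
Proof.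
move=> g0 mg; apply: (@measurable_iint _ (measurableTypeR R) R n
  (fun t y => g (scons t y))) => // d' T' a e ma me.
by apply: (mg _ _ (fun t => scons (a t) (e t))); exact: cmeas_scons.
Qed.

Lemma iintZ {R : realType} {n} (k : R) (g : 'rV[R]_n -> \bar R) :
  0 <= k -> (forall x, 0 <= g x)%E -> fdmeas g ->
  iint (fun x => k%:E * g x)%E = (k%:E * iint g)%E.
Proof.
move=> k0; elim: n g => [|n IH] g g0 mg //=.
under eq_integral => t _.
  rewrite (IH (fun y => g (scons t y))) //; last exact: fdmeas_scons.
  over.
rewrite (ge0_integralZl_EFin (T := measurableTypeR R)) //; last first.
  exact: measurable_iint_scons.
by move=> t _; exact: iint_ge0.
Qed.

(** Monotone convergence, one variable at a time; [fdmeas] passes to sections. *)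
Lemma iint_nneseries {R : realType} {n} (g : nat -> 'rV[R]_n -> \bar R) :
  (forall k x, 0 <= g k x)%E -> (forall k, fdmeas (g k)) ->
  iint (fun x => \sum_(k <oo) g k x)%E = (\sum_(k <oo) iint (g k))%E.
Proof.
elim: n g => [|n IH] g g0 mg //=.
under eq_integral => t _.
  rewrite (IH (fun k y => g k (scons t y))) //; last first.
    by move=> k; exact: fdmeas_scons.
  over.
rewrite (integral_nneseries (T := measurableTypeR R)) //.
  by move=> k; exact: measurable_iint_scons.
by move=> k t _; exact: iint_ge0.
Qed.

Definition cube {R : realType} {n} (z : 'rV[R]_n) (d : R) (x : 'rV[R]_n) : bool :=
  [forall i, `|x ord0 i - z ord0 i| <= d].

(** The constant [C] is generalised because the induction absorbs the indicator of the first
    coordinate into it. *)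
Lemma iint_cube {R : realType} {n} (z : 'rV[R]_n) (d C : R) :
  0 <= d -> 0 <= C ->
  iint (fun x => (C * (cube z d x)%:R)%:E) = (C * (2 * d) ^+ n)%:E.
Proof.
move=> d0; elim: n z C => [|n IH] z C C0 /=.
  by rewrite expr0; congr (_ * _)%:E; rewrite /cube; case: forallP => // -[] [].
pose z' : 'rV[R]_n := \row_i z ord0 (lift ord0 i).
have cubeS t y : cube z d (scons t y) = (`|t - z ord0 ord0| <= d) && cube z' d y.
  apply/forallP/andP => [h|[h1 /forallP h2] i].
    split; first by have := h ord0; rewrite scons0.
    by apply/forallP => i; have := h (lift ord0 i); rewrite sconsS mxE.
  have [j ->|->] := unliftP ord0 i; last by rewrite scons0.
  by have := h2 j; rewrite sconsS mxE.
pose I := `[z ord0 ord0 - d, z ord0 ord0 + d]%classic.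
have section (t : R) : iint (fun y => (C * (cube z d (scons t y))%:R)%:E)
    = ((C * (2 * d) ^+ n)%:E * (\1_I t)%:E)%E.
  have -> : (\1_I t : R) = (`|t - z ord0 ord0| <= d)%R%:R.
    rewrite indicE mem_setE in_itv /= ler_distl; congr (_ _)%:R.
  transitivity (iint (fun y => ((C * (`|t - z ord0 ord0| <= d)%R%:R) * (cube z' d y)%:R)%:E)).
    congr iint; apply/funext => y; rewrite cubeS.
    by congr EFin; case: (_ <= d); rewrite /= !(mulr1, mulr0, mul0r).
  rewrite IH; last by rewrite mulr_ge0.
  by rewrite -EFinM; congr EFin; ring.
transitivity ((C * (2 * d) ^+ n)%:E * \int[@lebesgue_measure R]_(t in [set: R]) (\1_I t)%:E)%E.
  rewrite -(ge0_integralZl_EFin (T := measurableTypeR R)) //.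
  - by apply: eq_integral => t _; rewrite -section.
  - apply/measurable_EFinP; apply: measurable_indic; exact: measurable_itv.
  - by rewrite mulr_ge0 // exprn_ge0 // mulr_ge0.
rewrite (integral_indic (T := measurableTypeR R)) //; last exact: measurable_itv.
rewrite setIT.
apply: (etrans (congr1 (mule _) (lebesgue_measure_itv _))); rewrite /= lte_fin.
(* The length formula gives zero unless the endpoints are strictly ordered. Otherwise [d = 0], and
   the right side vanishes too, its exponent being positive. *)
case: ltP => h; first by rewrite -!EFinD -EFinM; congr EFin; rewrite exprSr; ring.
have -> : d = 0 by lra.
by rewrite mule0 mulr0 expr0n mulr0.
Qed.

(** The open preimage under [G] is a countable union of open cubes with centres in the grid of mesh
    [1/(k+1)] and radius equal to the mesh. Each cube pulls back along [e] to a finite intersection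
    of coordinate conditions. *)
Lemma continuous_cmeas {d} {T : measurableType d} {R : realType} {n}
    (G : 'rV[R]_n -> R) (e : T -> 'rV[R]_n) :
  continuous G -> cmeas e -> measurable_fun [set: T] (G \o e).
Proof.
move=> /continuousP cG me; apply: (measurability _ (RGenOpens.measurableE R)).
move=> _ [_ [a [b ->] <-]]; rewrite setTI.
pose U := G @^-1` `]a, b[%classic.
have oU : open U by exact/cG/interval_open.
pose c (z : 'rV[int]_n) (k : nat) : 'rV[R]_n := \row_i ((z ord0 i)%:~R / k.+1%:R).
have -> : (G \o e) @^-1` `]a, b[%classic =
    \bigcup_(i : 'rV[int]_n * nat) [set t | ball (c i.1 i.2) i.2.+1%:R^-1 `<=` U /\
        forall j, `|c i.1 i.2 ord0 j - e t ord0 j| < i.2.+1%:R^-1].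
  apply/seteqP; split => [t Ut|t [[z k] _ [/= sU h]]]; last first.
    apply: sU; split => // i j; rewrite [i]ord1; exact: h.
  have /nbhs_ballP[eps /= eps0 sU] : nbhs (e t) U by exact: open_nbhs_nbhs.
  have [k hk] : exists k : nat, k.+1%:R^-1 < eps / 2.
    exists (Num.truncn (eps / 2)^-1).
    by rewrite invf_plt ?posrE ?divr_gt0 // truncnS_gt.
  (* Rounding down on the grid puts [e t] strictly within one mesh of the centre; as the mesh is
     below [eps / 2], the cube around the centre stays in the [eps] ball. *)
  exists (\row_i Num.floor (k.+1%:R * e t ord0 i), k) => //=.
  have k0 : 0 < k.+1%:R^-1 :> R by rewrite invr_gt0.
  have h j : `|c (\row_i Num.floor (k.+1%:R * e t ord0 i)) k ord0 j - e t ord0 j| < k.+1%:R^-1.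
    rewrite !mxE; set y := e t ord0 j.
    have /andP[] := floor_itv (k.+1%:R * y); set m := Num.floor _; rewrite intrD => h1 h2.
    have -> : m%:~R / k.+1%:R - y = (m%:~R - k.+1%:R * y) / k.+1%:R.
      by rewrite mulrBl mulrAC mulfV ?mul1r // pnatr_eq0.
    rewrite normrM (gtr0_norm k0) gtr_pMl // distrC ger0_norm ?subr_ge0 //.
    by rewrite ltrBlDl.
  split => // x [_ hx]; apply: sU; split => // i j; rewrite [i]ord1 /ball /=.
  rewrite distrC (splitr eps).
  apply: le_lt_trans (ler_distD (c (\row_i Num.floor (k.+1%:R * e t ord0 i)) k ord0 j) _ _) _.
  apply: ltrD; last by apply: lt_trans hk.
  by rewrite distrC; apply: lt_trans hk; exact: hx.
apply: countable_bigcupT_measurable; first exact: countableP.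
move=> [z k] /=.
have [sU|nsU] := pselect (ball (c z k) k.+1%:R^-1 `<=` U); last first.
  rewrite (_ : [set _ | _] = set0); first exact: measurable0.
  by apply/seteqP; split => // t [].
rewrite (_ : [set _ | _] = \bigcap_j
   ((fun t => e t ord0 j) @^-1` (ball (c z k ord0 j) k.+1%:R^-1))); last first.
  apply/seteqP; split => [t [_ h] j _|t h]; first exact: h.
  by split => // j; apply: (h j).
apply: fin_bigcap_measurable => // j _.
rewrite -[X in measurable X]setTI; apply: me => //.
exact: measurable_ball.
Qed.

(** * Weights and series *)

Definition pow2_weight (n : nat) : nat := if (2 ^ trunc_log 2 n == n)%N then n else 0%N.

Lemma pow2_weightX k : pow2_weight (2 ^ k) = (2 ^ k)%N.
Proof. by rewrite /pow2_weight trunc_expnK // eqxx. Qed.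

(** The powers of 2 up to [n] add up to less than twice the largest one. The induction therefore
    runs on the sharper bound [2 * 2 ^ trunc_log 2 n]. *)
Lemma sum_pow2_weight n : (\sum_(i < n) pow2_weight i <= 2 * n)%N.
Proof.
case: n => [|n]; first by rewrite big_ord0.
suff h : (\sum_(i < n.+1) pow2_weight i <= 2 * 2 ^ trunc_log 2 n)%N.
  apply: leq_trans h _; rewrite leq_mul2l /=; case: n => [//|n].
  exact: leq_trans (trunc_logP _ _) _.
elim: n => [|n IH]; first by rewrite big_ord_recr big_ord0.
rewrite big_ord_recr /= {2}/pow2_weight.
have mono : (2 ^ trunc_log 2 n <= 2 ^ trunc_log 2 n.+1)%N.
  by rewrite leq_exp2l // leq_trunc_log.
case: eqP => e; last by apply: leq_trans (leq_add IH (leqnn _)) _; lia.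
case: n => [|n] in IH mono e *; first by rewrite big_ord_recr big_ord0.
(* At a new power of 2 the logarithm jumps, so the earlier sum is at most [n.+2], which leaves room
   for the new weight [n.+2]. *)
have lt : (trunc_log 2 n.+1 < trunc_log 2 n.+2)%N.
  by rewrite -(ltn_exp2l _ _ (isT : (1 < 2)%N)) e ltnS trunc_logP.
have : (2 ^ (trunc_log 2 n.+1).+1 <= 2 ^ trunc_log 2 n.+2)%N by rewrite leq_exp2l.
rewrite expnS e; move: IH; set S := (\sum_(i < _) _)%N; set P := (2 ^ _)%N.
move=> IH h; apply: leq_trans (leq_add IH (leqnn _)) _; lia.
Qed.

(* Abel summation: nonnegative partial sums stay nonnegative after weighting by a
   nonincreasing geometric sequence. *)
Lemma sum_mul_exp_ge0 {R : realFieldType} (d : nat -> R) (y : R) n :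
  0 <= y <= 1 -> (forall m, 0 <= \sum_(i < m) d i) ->
  y ^+ n * (\sum_(i < n) d i) <= \sum_(i < n) d i * y ^+ i.
Proof.
move=> /andP[y0 y1] d0; elim: n => [|n IH]; first by rewrite !big_ord0 mulr0.
apply: (@le_trans _ _ (y ^+ n * \sum_(i < n.+1) d i)).
  by rewrite exprS -mulrA ler_piMl // mulr_ge0 // exprn_ge0.
by rewrite 2!big_ord_recr /= mulrDr lerD // mulrC.
Qed.

Lemma sum_geometric_le {R : realFieldType} (y : R) n :
  0 <= y < 1 -> \sum_(i < n) y ^+ i <= (1 - y)^-1.
Proof.
move=> /andP[y0 y1]; have p : 0 < 1 - y by rewrite subr_gt0.
rewrite -[leRHS]mul1r ler_pdivlMr // mulrC.
have -> : (1 - y) * (\sum_(i < n) y ^+ i) = 1 - y ^+ n.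
  by rewrite -opprB mulNr -subrX1 opprB.
by rewrite gerBl exprn_ge0.
Qed.

(** The constant weight [2] has larger partial sums, and Abel summation carries this over to
    geometric weights, although single weights are unbounded. *)
Lemma sum_pow2_weight_geometric {R : realFieldType} (y : R) n :
  0 <= y < 1 -> \sum_(i < n) (pow2_weight i)%:R * y ^+ i <= 2 / (1 - y).
Proof.
move=> y01; have /andP[y0 y1] := y01.
apply: (@le_trans _ _ (2 * \sum_(i < n) y ^+ i)); last first.
  by rewrite ler_pM2l // sum_geometric_le.
have S m : 0 <= \sum_(i < m) (2 - (pow2_weight i)%:R : R).
  rewrite sumrB subr_ge0 -natr_sum sumr_const card_ord -mulrnA ler_nat.
  exact: sum_pow2_weight.
have := @sum_mul_exp_ge0 _ (fun i => 2 - (pow2_weight i)%:R) y n.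
rewrite y0 ltW // => /(_ isT S) h.
rewrite mulr_sumr -subr_ge0 -sumrB.
under eq_bigr do rewrite -mulrBl.
apply: le_trans h; rewrite mulr_ge0 // exprn_ge0 //.
Qed.

Lemma nneseries_fin_le {R : realType} (u : nat -> R) (K : R) :
  (forall n, 0 <= u n) -> (forall n, \sum_(i < n) u i <= K) ->
  (\sum_(i <oo) (u i)%:E <= K%:E)%E.
Proof.
move=> u0 uK; apply: lime_le.
  by apply: is_cvg_nneseries => n _ _; rewrite lee_fin.
by apply: nearW => n; rewrite big_mkord sumEFin lee_fin.
Qed.

Lemma nneseries_single {R : realType} (u : nat -> \bar R) k :
  (forall n, n != k -> u n = 0%E) -> (forall n, 0 <= u n)%E ->
  (\sum_(n <oo) u n = u k)%E.
Proof.
move=> uk u0; rewrite nneseries_esumT //.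
rewrite (_ : u = fun n => if n \in [set k] then u n else 0%E); last first.
  apply/funext => n; case: ifPn => // nk; apply: uk.
  by apply: contra nk => /eqP ->; rewrite mem_set.
by rewrite -esum_mkcond esum_set1 // mem_set.
Qed.

(** With [u = t * ln 2] this is [exp(-u) (1 + u) <= 1]. It bounds [1 - 2^(-t)] below linearly for
    bounded [t]. *)
Lemma powR2N_gap {R : realType} (t : R) : 0 < t ->
  t * ln 2 <= (1 - 2 `^ (- t)) * (1 + t * ln 2).
Proof.
move=> t0; have l0 : 0 < ln 2 :> R by rewrite ln_gt0 // ltr1n.
have u0 : 0 < t * ln 2 by rewrite mulr_gt0.
rewrite /powR pnatr_eq0 /= mulNr expRN.
have h : 1 + t * ln 2 <= expR (t * ln 2) by exact: expR_ge1Dx.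
have e0 : 0 < expR (t * ln 2) by exact: expR_gt0.
rewrite mulrBl mul1r lerBrDr -lerBrDl addrK.
by rewrite ler_pdivrMl // mulr1.
Qed.

(** * Sums of separated dilated atoms *)

Section Atoms.
Context {R : realType} {n : nat}.
Variables (psi : 'rV[R]_n.+1 -> R) (A : R) (L : nat) (c : nat -> R).

(** The factor [2 ^ nu] compensates the dilation, so the centre of [atom nu] is [L * nu] on the
    first axis; integrality makes the atom a quark up to a scalar. *)
Definition site (nu : nat) : 'rV[int]_n.+1 :=
  \row_i (if i == ord0 then (2 ^ nu * (L * nu))%N%:Z else 0).

Definition atom (nu : nat) (x : 'rV[R]_n.+1) : R :=
  psi (2 ^+ nu *: x - map_mx (fun z : int => z%:~R) (site nu)).

(** With separated supports at most one term is nonzero at each point, so [fine] discards no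
    infinite value. *)
Definition atom_sum (x : 'rV[R]_n.+1) : R := fine (\sum_(nu <oo) (c nu * atom nu x)%:E)%E.

Definition atom_center (nu : nat) : 'rV[R]_n.+1 :=
  \row_i (if i == ord0 then (L * nu)%:R else 0).

Lemma atom_arg nu (x : 'rV[R]_n.+1) i :
  (2 ^+ nu *: x - map_mx (fun z : int => z%:~R) (site nu)) ord0 i
  = 2 ^+ nu * (x ord0 i - atom_center nu ord0 i).
Proof.
rewrite !mxE mulrBr; congr (_ - _); case: ifP => _; last by rewrite mulr0.
by rewrite -pmulrn (natrM _ (2 ^ nu)) natrX.
Qed.

Hypothesis psi_ge0 : forall x, 0 <= psi x.
Hypothesis psi_le1 : forall x, psi x <= 1.
Hypothesis psi_supp : forall x, psi x != 0 -> forall i, `|x ord0 i| < A.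
Hypothesis psi_cont : continuous psi.
Hypothesis A_gt0 : 0 < A.
Hypothesis L_large : 2 * A + 1 <= L%:R.
Hypothesis c_ge0 : forall nu, 0 <= c nu.

Lemma atom_ge0 nu x : 0 <= atom nu x. Proof. exact: psi_ge0. Qed.

Lemma atom_le1 nu x : atom nu x <= 1. Proof. exact: psi_le1. Qed.

Lemma atom_supp nu x : atom nu x != 0 ->
  forall i, `|x ord0 i - atom_center nu ord0 i| < A / 2 ^+ nu.
Proof.
move=> /psi_supp h i; have := h i; rewrite atom_arg normrM.
rewrite (ger0_norm (_ : 0 <= 2 ^+ nu)) ?exprn_ge0 // => h'.
by rewrite ltr_pdivlMr ?exprn_gt0 // mulrC.
Qed.

Lemma atom_supp0 nu x : atom nu x != 0 -> `|x ord0 ord0 - (L * nu)%:R| < A.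
Proof.
move=> /atom_supp /(_ ord0); rewrite mxE eqxx => /lt_le_trans; apply.
rewrite ler_pdivrMr ?exprn_gt0 // ler_peMr //; first exact: ltW.
by rewrite exprn_ege1 // ler1n.
Qed.

(** The first coordinates of two centres differ by at least [L], which exceeds [2 * A]. *)
Lemma atom_disjoint mu nu x : mu != nu -> atom nu x != 0 -> atom mu x = 0.
Proof.
move=> ne hn; apply/eqP; apply: contraT => hm.
have := atom_supp0 _ _ hn; have := atom_supp0 _ _ hm.
wlog lt : mu nu ne hn hm / (mu < nu)%N => [H|].
  have [lt|lt|/eqP] := ltngtP mu nu; last by rewrite (negPf ne).
    exact: H hn hm lt.
  by move=> h1 h2; apply: (H nu mu) => //; rewrite eq_sym.
rewrite !ltr_norml => /andP[a1 a2] /andP[b1 b2].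
have : ((L * mu)%:R + L%:R <= (L * nu)%:R :> R).
  by rewrite -natrD ler_nat -mulnSr leq_mul2l lt orbT.
move: L_large A_gt0; lra.
Qed.

Lemma atom_continuous nu : continuous (atom nu).
Proof.
pose g (x : 'rV[R]_n.+1) := 2 ^+ nu *: x - map_mx (fun z : int => z%:~R) (site nu).
have cg : continuous g.
  move=> x; apply: (@continuousB _ 'rV[R]_n.+1 'rV[R]_n.+1); last exact: cst_continuous.
  exact: scaler_continuous.
move=> x; exact: (continuous_comp (cg x) (psi_cont _)).
Qed.

Lemma atom_cases x :
  (forall nu, atom nu x = 0) \/
  exists2 nu, atom nu x != 0 & forall mu, mu != nu -> atom mu x = 0.
Proof.
have [[nu h]|h] := pselect (exists nu, atom nu x != 0).
  by right; exists nu => // mu ne; exact: atom_disjoint h.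
by left => nu; apply/eqP; apply: contrapT => /negP h'; apply: h; exists nu.
Qed.

Lemma atom_sum_at nu x : (forall mu, mu != nu -> atom mu x = 0) ->
  atom_sum x = c nu * atom nu x.
Proof.
move=> h; rewrite /atom_sum (@nneseries_single _ _ nu) //.
  by move=> mu ne; rewrite h // mulr0.
by move=> mu; rewrite lee_fin mulr_ge0 // atom_ge0.
Qed.

(** Even a nonlinear [F] commutes with the sum, since at most one term is nonzero and [F 0 = 0]. *)
Lemma atom_sum_series (F : R -> R) x : F 0 = 0 -> (forall t, 0 <= t -> 0 <= F t) ->
  (F (atom_sum x))%:E = (\sum_(nu <oo) (F (c nu * atom nu x))%:E)%E.
Proof.
move=> F0 Fp.
have [h|[nu hnu h]] := atom_cases x.
  rewrite (atom_sum_at 0) ?(@nneseries_single _ _ 0%N) //.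
  - by move=> mu _; rewrite h mulr0 F0.
  - by move=> mu; rewrite lee_fin Fp // mulr_ge0 // atom_ge0.
rewrite (atom_sum_at nu) ?(@nneseries_single _ _ nu) //.
- by move=> mu ne; rewrite h // mulr0 F0.
- by move=> mu; rewrite lee_fin Fp // mulr_ge0 // atom_ge0.
Qed.

Lemma atom_sum_ge0 x : 0 <= atom_sum x.
Proof.
apply: fine_ge0; apply: nneseries_ge0 => nu _ _.
by rewrite lee_fin mulr_ge0 // atom_ge0.
Qed.

Lemma measurable_atom_sum {d} {T : measurableType d} (e : T -> 'rV[R]_n.+1) :
  cmeas e -> measurable_fun [set: T] (atom_sum \o e).
Proof.
move=> me; apply: (measurableT_comp (fine_measurable measurableT)).
apply: ge0_emeasurable_sum => [nu x _ _|nu _].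
  by rewrite lee_fin mulr_ge0 // atom_ge0.
apply/measurable_EFinP; apply: measurable_funM; first exact: measurable_cst.
by apply: continuous_cmeas me; exact: atom_continuous.
Qed.

Lemma iint_atom_le nu (g : 'rV[R]_n.+1 -> R) (K : R) : 0 <= K ->
  (forall x, 0 <= g x) -> (forall x, atom nu x = 0 -> g x = 0) -> (forall x, g x <= K) ->
  (iint (fun x => (g x)%:E) <= (K * (2 * (A / 2 ^+ nu)) ^+ n.+1)%:E)%E.
Proof.
move=> K0 g0 gz gK.
rewrite -(@iint_cube _ _ (atom_center nu)) //; last first.
  by rewrite divr_ge0 ?exprn_ge0 // ltW.
apply: le_iint => x; first by rewrite lee_fin.
rewrite lee_fin; have [/gz ->|h] := eqVneq (atom nu x) 0; first by rewrite mulr_ge0.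
rewrite /cube; have -> : [forall i, `|x ord0 i - atom_center nu ord0 i| <= A / 2 ^+ nu].
  by apply/forallP => i; apply: ltW; exact: atom_supp.
by rewrite mulr1.
Qed.

(** The case [e = id] of [measurable_atom_sum]: coordinates are continuous, hence measurable for the
    sigma-algebra generated by the open sets. *)
Lemma borel_atom_sum : borel_RN atom_sum.
Proof.
move=> B mB.
pose T := g_sigma_algebraType [set U : set 'rV[R]_n.+1 | open U].
have me : @cmeas _ T R n.+1 id.
  move=> i; apply: (measurability _ (RGenOpens.measurableE R)).
  move=> _ [_ [a [b ->] <-]]; rewrite setTI; apply: sub_sigma_algebra.
  have /continuousP := @coord_continuous R 1 n.+1 ord0 i; apply.
  exact: interval_open.
have := measurable_atom_sum _ me measurableT B mB.
by rewrite setTI.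
Qed.

End Atoms.

Lemma nneseries_geometric_lt {R : realType} (u : nat -> \bar R) (D y : R) :
  0 <= y < 1 -> 0 <= D -> (forall nu, 0 <= u nu)%E ->
  (forall nu, u nu <= (D * y ^+ nu)%:E)%E -> (\sum_(nu <oo) u nu < +oo)%E.
Proof.
move=> y01 D0 u0 uD; have /andP[y0 y1] := y01.
apply: (@le_lt_trans _ _ (\sum_(nu <oo) (D * y ^+ nu)%:E)%E).
  by apply: lee_nneseries => nu _ //; exact: uD.
apply: (@le_lt_trans _ _ (D / (1 - y))%:E); last exact: ltry.
apply: nneseries_fin_le => m; first by rewrite mulr_ge0 // exprn_ge0.
by rewrite -mulr_sumr ler_wpM2l // sum_geometric_le.
Qed.

(** Serves to collapse the sum over all triples (beta, nu, m) to the single index per level that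
    carries a coefficient. *)
Lemma esum_range {R : realType} {T : choiceType} (e : nat -> T) (h : T -> \bar R) :
  injective e -> (forall i, 0 <= h i)%E -> (forall i, (forall k, i != e k) -> h i = 0%E) ->
  (\esum_(i in [set: T]) h i = \esum_(k in [set: nat]) h (e k))%E.
Proof.
move=> inj h0 hz; rewrite -(esum_image [set: nat] e); last by move=> x y _ _ /inj.
rewrite [RHS]esum_mkcond; apply: eq_esum => i _; case: ifPn => // ni.
apply: hz => k; apply: contra ni => /eqP ->; apply/mem_set; by exists k.
Qed.

Lemma measurable_max0 {d} {T : measurableType d} {R : realType} (g : T -> R) :
  measurable_fun [set: T] g -> measurable_fun [set: T] (fun x => Num.max (g x) 0).
Proof. by move=> mg; apply: measurable_maxr => //; exact: measurable_cst. Qed.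

(** * Integrals of atom sums and membership in L^p *)

Section AtomIntegrals.
Context {R : realType} {n : nat}.
Variables (psi : 'rV[R]_n.+1 -> R) (A : R) (L : nat) (c : nat -> R).
Hypothesis psi_ge0 : forall x, 0 <= psi x.
Hypothesis psi_le1 : forall x, psi x <= 1.
Hypothesis psi_supp : forall x, psi x != 0 -> forall i, `|x ord0 i| < A.
Hypothesis psi_cont : continuous psi.
Hypothesis A_gt0 : 0 < A.
Hypothesis L_large : 2 * A + 1 <= L%:R.
Hypothesis c_ge0 : forall nu, 0 <= c nu.

Local Notation f := (atom_sum psi L c).
Local Notation atom := (atom psi L).

(** Used twice: with [F] a power and [theta = 1] for the L^p norm, and with [F] the identity and
    [theta] a signed part of a test function for the pairing. *)
Lemma iint_atom_sum (F : R -> R) (theta : 'rV[R]_n.+1 -> R) :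
  F 0 = 0 -> (forall t, 0 <= t -> 0 <= F t) -> measurable_fun [set: R] F ->
  (forall x, 0 <= theta x) ->
  (forall d (T : measurableType d) (e : T -> 'rV[R]_n.+1),
     cmeas e -> measurable_fun [set: T] (theta \o e)) ->
  iint (fun x => (F (f x) * theta x)%:E)
  = (\sum_(nu <oo) iint (fun x => (F (c nu * atom nu x)%R * theta x)%:E))%E.
Proof.
move=> F0 Fp mF t0 mt.
rewrite -iint_nneseries.
- congr iint; apply/funext => x.
  apply: (atom_sum_series _ A _ _ psi_ge0 psi_supp A_gt0 L_large c_ge0 (fun t => F t * theta x)).
    by rewrite F0 mul0r.
  by move=> t tp; rewrite mulr_ge0 // Fp.
- by move=> nu x; rewrite lee_fin mulr_ge0 // Fp // mulr_ge0 // atom_ge0.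
move=> nu d T e me; apply/measurable_EFinP.
apply: measurable_funM; last exact: mt.
apply: (measurableT_comp mF); apply: measurable_funM; first exact: measurable_cst.
by apply: continuous_cmeas me; exact: atom_continuous.
Qed.

Lemma atom_sum_inLp (p D y : R) : 1 <= p -> 0 <= y < 1 -> 0 <= D ->
  (forall nu, c nu `^ p * (2 ^- nu) ^+ n.+1 <= D * y ^+ nu) -> inLp p f.
Proof.
move=> p1 y01 D0 hc; split; first exact: borel_atom_sum.
have p0 : p != 0 by rewrite gt_eqF // (lt_le_trans _ p1).
have -> : (fun x => (`|f x| `^ p)%:E) = (fun x => ((fun t => `|t| `^ p) (f x) * cst 1 x)%:E).
  by apply/funext => x; rewrite /= mulr1.
rewrite (iint_atom_sum (fun t => `|t| `^ p)) //; last 3 first.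
- by rewrite /= normr0 powR0.
- apply: (measurableT_comp (measurable_powR p)); exact: normr_measurable.
- by move=> d T e _; exact: measurable_cst.
apply: (@nneseries_geometric_lt _ _ ((2 * A) ^+ n.+1 * D) y) => //.
- by rewrite mulr_ge0 // exprn_ge0 // mulr_ge0 // ltW.
- by move=> nu; apply: iint_ge0 => x; rewrite lee_fin mulr_ge0 // powR_ge0.
move=> nu.
apply: le_trans (iint_atom_le _ A L psi_supp A_gt0 nu _ (c nu `^ p) _ _ _ _) _.
- exact: powR_ge0.
- by move=> x; rewrite mulr1 powR_ge0.
- by move=> x ->; rewrite mulr0 normr0 powR0 // mul0r.
- move=> x; rewrite mulr1 ger0_norm ?mulr_ge0 // ?atom_ge0 //.
  apply: ge0_ler_powR; rewrite ?nnegrE ?mulr_ge0 ?atom_ge0 //.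
    exact: le_trans ler01 p1.
  by rewrite ler_piMr // atom_le1.
rewrite lee_fin mulrA exprMn mulrCA -mulrA ler_wpM2l //.
by rewrite exprn_ge0 // mulr_ge0 // ltW.
Qed.

Lemma iint_atom_weight_le nu (theta : 'rV[R]_n.+1 -> R) (D y K : R) :
  0 <= K -> (forall x, 0 <= theta x <= K) ->
  (forall nu, c nu * (2 ^- nu) ^+ n.+1 <= D * y ^+ nu) ->
  (iint (fun x => (c nu * atom nu x * theta x)%:E) <= (K * (2 * A) ^+ n.+1 * D * y ^+ nu)%:E)%E.
Proof.
move=> K0 tK hc.
apply: le_trans (iint_atom_le _ A L psi_supp A_gt0 nu _ (c nu * K) _ _ _ _) _.
- by rewrite mulr_ge0.
- move=> x; have /andP[t0 _] := tK x.
  by rewrite mulr_ge0 // mulr_ge0 // atom_ge0.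
- by move=> x ->; rewrite mulr0 mul0r.
- move=> x; have /andP[t0 t1] := tK x.
  by rewrite ler_pM ?mulr_ge0 ?atom_ge0 // ler_piMr // atom_le1.
rewrite lee_fin [X in X ^+ n.+1]mulrA [X in _ * X <= _]exprMn.
rewrite [leLHS](_ : _ = K * (2 * A) ^+ n.+1 * (c nu * 2 ^- nu ^+ n.+1)); last by ring.
rewrite -[leRHS]mulrA ler_wpM2l //.
by rewrite mulr_ge0 // exprn_ge0 // mulr_ge0 // ltW.
Qed.

End AtomIntegrals.

(** * The quark expansion of an atom sum in the sense of distributions *)

Section AtomRepresentation.
Context {R : realType} {n : nat}.
Variables (psi : 'rV[R]_n.+1 -> R) (A : R) (L : nat) (c : nat -> R).
Hypothesis psi_ge0 : forall x, 0 <= psi x.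
Hypothesis psi_le1 : forall x, psi x <= 1.
Hypothesis psi_supp : forall x, psi x != 0 -> forall i, `|x ord0 i| < A.
Hypothesis psi_cont : continuous psi.
Hypothesis A_gt0 : 0 < A.
Hypothesis L_large : 2 * A + 1 <= L%:R.
Hypothesis c_ge0 : forall nu, 0 <= c nu.

Local Notation f := (atom_sum psi L c).
Local Notation atom := (atom psi L).

(** The power of 2 undoes the normalisation of the quark, so every [r] represents the same
    function. *)
Definition atom_coefs (r p : R) : coefs R n.+1 := fun b nu m =>
  if (b == const_mx 0%N) && (m == site L nu)
  then c nu * 2 `^ (nu%:R * (r - n.+1%:R / p)) else 0.

Lemma quark_atom (r p : R) nu x :
  quark psi r p (const_mx 0%N) nu (site L nu) x
  = 2 `^ (- (nu%:R * (r - n.+1%:R / p))) * atom nu x.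
Proof.
rewrite /quark /=; congr (_ * _); rewrite -[RHS]mul1r; congr (_ * _).
by rewrite /monom big1 // => i _; rewrite [const_mx _ _ _]mxE expr0.
Qed.

Lemma integralRN_atom (k : R) nu (phi : 'rV[R]_n.+1 -> R) :
  0 <= k -> (forall d (T : measurableType d) (e : T -> 'rV[R]_n.+1),
     cmeas e -> measurable_fun [set: T] (phi \o e)) ->
  integralRN (fun x => k * atom nu x * phi x)
  = (k%:E * iint (fun x => (atom nu x * Num.max (phi x) 0)%:E)
    - k%:E * iint (fun x => (atom nu x * Num.max (- phi x) 0)%:E))%E.
Proof.
move=> k0 mphi; rewrite /integralRN.
have H (theta : 'rV[R]_n.+1 -> R) :
    (forall d (T : measurableType d) (e : T -> 'rV[R]_n.+1),
     cmeas e -> measurable_fun [set: T] (theta \o e)) ->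
    iint (fun x => (Num.max (k * atom nu x * theta x) 0)%:E)
    = (k%:E * iint (fun x => (atom nu x * Num.max (theta x) 0)%:E))%E.
  move=> mt; rewrite -iintZ //.
  - congr iint; apply/funext => x; rewrite -EFinM mulrA; congr EFin.
    by rewrite maxr_pMr ?mulr0 // mulr_ge0 // atom_ge0.
  - by move=> x; rewrite lee_fin mulr_ge0 ?atom_ge0 // le_max lexx orbT.
  move=> d T e me; apply/measurable_EFinP; apply: measurable_funM.
    by apply: continuous_cmeas me; exact: atom_continuous.
  by apply: measurable_max0; exact: mt.
rewrite H //; congr (_ - _)%E; rewrite -H; last first.
  by move=> d T e me; apply: measurableT_comp; [exact: oppr_measurable|exact: mphi].
by congr iint; apply/funext => x; rewrite mulrN.
Qed.

(** A test function is bounded, so the pairings of its positive and negative parts with the pieces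
    decay geometrically. Both series are summable, and may be subtracted termwise. *)
Lemma represents_atom_sum (r p D y : R) :
  0 <= y < 1 -> 0 <= D ->
  (forall nu, c nu * (2 ^- nu) ^+ n.+1 <= D * y ^+ nu) ->
  represents psi r p (atom_coefs r p) f.
Proof.
move=> y01 D0 hc phi [sphi dphi] a.
have cphi : continuous phi.
  by move=> x; apply: differentiable_continuous; exact: (sphi [::] x).
have mphi d (T : measurableType d) (e : T -> 'rV[R]_n.+1) :
    cmeas e -> measurable_fun [set: T] (phi \o e).
  exact: continuous_cmeas.
have [K phiK] : exists K, forall x, `|phi x| <= K.
  (* The Schwartz bound with trivial monomial and no derivative. *)
  have [K hK] := dphi (const_mx 0%N) [::]; exists K => x.
  have := hK x; rewrite /= /monom big1 ?mul1r // => i _; by rewrite [const_mx _ _ _]mxE expr0.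
have K0 : 0 <= K by apply: le_trans (phiK 0).
(* For [sg = 1] and [sg = -1] these are the positive and negative parts of [phi]. *)
pose part (sg : R) x := Num.max (sg * phi x) 0.
pose P sg nu := iint (fun x => (c nu * atom nu x * part sg x)%:E).
have part0 sg x : 0 <= part sg x by rewrite le_max lexx orbT.
have mpart sg d (T : measurableType d) (e : T -> 'rV[R]_n.+1) :
    cmeas e -> measurable_fun [set: T] (part sg \o e).
  move=> me; apply: measurable_max0; apply: measurable_funM; first exact: measurable_cst.
  exact: mphi.
have partK sg x : `|sg| = 1 -> 0 <= part sg x <= K.
  move=> sg1; rewrite part0 /= ge_max K0 andbT; apply: le_trans (phiK x).
  by apply: le_trans (ler_norm _) _; rewrite normrM sg1 mul1r.
have P0 sg nu : (0 <= P sg nu)%E.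
  by apply: iint_ge0 => x; rewrite lee_fin mulr_ge0 // mulr_ge0 // atom_ge0.
have PD sg nu : `|sg| = 1 -> (P sg nu <= (K * (2 * A) ^+ n.+1 * D * y ^+ nu)%:E)%E.
  move=> sg1; apply: (iint_atom_weight_le _ A L c) => // x; exact: partK.
have Pfin sg nu : `|sg| = 1 -> P sg nu \is a fin_num.
  by move=> sg1; rewrite ge0_fin_numE //; apply: le_lt_trans (PD _ _ sg1) (ltry _).
have Psum sg : `|sg| = 1 ->
    iint (fun x => (Num.max (sg * (f x * phi x)) 0)%:E) = (\sum_(nu <oo) P sg nu)%E.
  move=> sg1; rewrite -(iint_atom_sum _ A L c _ _ _ _ _ _ id (part sg)) //; last exact: mpart.
  congr iint; apply/funext => x /=; congr EFin.
  by rewrite /part maxr_pMr ?mulr0 ?atom_sum_ge0 // mulrCA.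
have Psummable sg : `|sg| = 1 -> summable [set: nat] (P sg).
  move=> sg1; rewrite /summable.
  under eq_esum do rewrite gee0_abs //.
  rewrite -nneseries_esumT //.
  apply: (@nneseries_geometric_lt _ _ (K * (2 * A) ^+ n.+1 * D) y) => //.
    by rewrite !mulr_ge0 // exprn_ge0 // mulr_ge0 // ltW.
  by move=> nu; exact: PD.
have n1 : `|1 : R| = 1 by rewrite normr1.
have nN1 : `|- 1 : R| = 1 by rewrite normrN normr1.
pose ix nu : 'rV[nat]_n.+1 * nat * 'rV[int]_n.+1 := (const_mx 0%N, nu, site L nu).
have ix_inj : injective ix by move=> mu nu [].
have aix nu : (a (ix nu))%:E = (P 1%R nu - P (- 1)%R nu)%E.
  rewrite /a /= /atom_coefs !eqxx /=; set k := 2 `^ _.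
  have k0 : 0 < k by exact: powR_gt0.
  under [fun x : 'rV_n.+1 => _]eq_fun do rewrite quark_atom powRN -/k.
  rewrite integralRN_atom //; last by rewrite invr_ge0 ltW.
  have E sg : P sg nu = ((c nu)%:E * iint (fun x => (atom nu x * part sg x)%:E))%E.
    rewrite -iintZ //.
    - by congr iint; apply/funext => x; rewrite -EFinM mulrA.
    - by move=> x; rewrite lee_fin mulr_ge0 // atom_ge0.
    move=> d T e me; apply/measurable_EFinP; apply: measurable_funM; last exact: mpart.
    by apply: continuous_cmeas me; exact: atom_continuous.
  have -> : (fun x => (atom nu x * Num.max (phi x) 0)%:E)
      = (fun x => (atom nu x * part 1 x)%:E).
    by apply/funext => x; rewrite /part mul1r.
  have -> : (fun x => (atom nu x * Num.max (- phi x) 0)%:E)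
      = (fun x => (atom nu x * part (- 1) x)%:E).
    by apply/funext => x; rewrite /part mulN1r.
  have := Pfin _ nu n1; have := Pfin _ nu nN1; rewrite !E.
  (* Finiteness of [c nu * I] yields that of [I] only when [c nu] is positive; when it is zero both
     sides vanish. *)
  have := c_ge0 nu; rewrite le_eqVlt => /predU1P[<-|cp].
    by rewrite !mul0r !mul0e sube0.
  have fin (I : \bar R) : ((c nu)%:E * I)%E \is a fin_num -> I = (fine I)%:E.
    by case: I => [u| |] //=; rewrite ?gt0_muley ?gt0_muleNy.
  move=> /fin -> /fin ->; rewrite -!EFinM -!EFinB /=; congr EFin.
  by rewrite -mulrBr -mulrBr mulrA mulfK // gt_eqF.
have az i : (forall nu, i != ix nu) -> a i = 0.
  case: i => [[b nu] m] ne; rewrite /a /= /atom_coefs.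
  case: ifP => [/andP[/eqP bE /eqP mE]|_]; last by rewrite mul0r.
  by have := ne nu; rewrite bE mE eqxx.
have sumE (H : R -> R) : H 0 = 0 -> (forall t, 0 <= H t) ->
    (\esum_(i in [set: 'rV[nat]_n.+1 * nat * 'rV[int]_n.+1]) (H (a i))%:E
     = \esum_(nu in [set: nat]) (H (a (ix nu)))%:E)%E.
  move=> H0 Hp; rewrite (esum_range ix) // => i; first by rewrite lee_fin.
  by move=> /az ->; rewrite H0.
split.
  rewrite (sumE Num.norm) ?normr0 //.
  have := summableB (Psummable _ n1) (Psummable _ nN1).
  rewrite /summable; congr (_ < _)%E; apply: eq_esum => nu _.
  by rewrite -aix.
rewrite (sumE (fun t => Num.max t 0)) ?maxxx //; last by move=> t; rewrite le_max lexx orbT.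
rewrite (sumE (fun t => Num.max (- t) 0)) ?oppr0 ?maxxx //; last first.
  by move=> t; rewrite le_max lexx orbT.
have -> : integralRN (fun x => f x * phi x) =
    (\esum_(nu in [set: nat]) P 1%R nu - \esum_(nu in [set: nat]) P (- 1)%R nu)%E.
  rewrite /integralRN -!nneseries_esumT // -!Psum //.
  by congr (_ - _)%E; congr iint; apply/funext => x; rewrite ?mul1r ?mulN1r.
(* The difference of the two sums becomes sums of positive and negative parts of termwise
   differences, which [aix] identifies with [a]. *)
rewrite -(esumB (Psummable _ n1) (Psummable _ nN1)) //.
congr (_ - _)%E; apply: eq_esum => nu _.
- by rewrite funeposE -aix EFin_max.
- by rewrite funenegE -aix EFin_max.
Qed.

End AtomRepresentation.

(** * Norms and finite differences of atom sums *)

Lemma poweR_le {R : realType} (r : R) (x y : \bar R) :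
  0 <= r -> (0 <= x)%E -> (x <= y)%E -> (poweR x r <= poweR y r)%E.
Proof.
move=> r0 x0 xy; apply: gt0_ler_poweR => //; rewrite in_itv /= leey andbT //.
exact: le_trans xy.
Qed.

Lemma coef_norm_atom_coefs {R : realType} {n : nat} (L : nat) (c : nat -> R)
    (rho r p q K : R) : 1 <= p -> 1 <= q ->
  (\sum_(nu <oo) (`|c nu * 2 `^ (nu%:R * (r - n.+1%:R / p))| `^ q)%:E <= K%:E)%E ->
  (coef_norm rho p q (atom_coefs (n := n) L c r p) <= (K `^ q^-1)%:E)%E.
Proof.
move=> p1 q1 hK.
have p0 : p != 0 by rewrite gt_eqF // (lt_le_trans _ p1).
have q0 : 0 < q by exact: lt_le_trans q1.
apply: ge_ereal_sup => _ [b _ <-].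
have inner nu : (\esum_(m in [set: 'rV[int]_n.+1]) (`|atom_coefs L c r p b nu m| `^ p)%:E
    = (`|atom_coefs L c r p b nu (site L nu)| `^ p)%:E)%E.
  rewrite -[RHS](@esum_set1 R 'rV[int]_n.+1 (site L nu)
    (fun m => (`|atom_coefs L c r p b nu m| `^ p)%:E)) ?lee_fin ?powR_ge0 //.
  rewrite [RHS]esum_mkcond; apply: eq_esum => m _.
  case: ifPn => // ne; rewrite /atom_coefs; case: ifP => [/andP[_ /eqP mE]|_].
    by rewrite mE mem_set in ne.
  by rewrite normr0 powR0.
under eq_esum do rewrite inner poweR_EFin -powRrM mulrCA mulfV // mulr1.
rewrite -nneseries_esumT; last by move=> nu; rewrite lee_fin powR_ge0.
have [bE|/negPf bN] := eqVneq b (const_mx 0%N).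
  rewrite bE /mlen (eq_bigr (fun=> 0%N)); last by move=> i _; rewrite mxE.
  rewrite big1 // mulr0 powRr0 mul1e -poweR_EFin.
  apply: poweR_le; first by rewrite invr_ge0 ltW.
    by apply: nneseries_ge0 => nu _ _; rewrite lee_fin powR_ge0.
  apply: le_trans hK; apply: lee_nneseries => nu _; first by rewrite lee_fin powR_ge0.
  by rewrite /atom_coefs !eqxx.
rewrite eseries0 ?poweR0r ?invr_neq0 ?gt_eqF // ?mule0 ?lee_fin ?powR_ge0 //.
by move=> nu _ _; rewrite /atom_coefs bN /= normr0 powR0 // gt_eqF.
Qed.

Section AtomDifferences.
Context {R : realType} {n : nat}.
Variables (psi : 'rV[R]_n.+1 -> R) (A : R) (L : nat) (c : nat -> R).
Hypothesis psi_ge0 : forall x, 0 <= psi x.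
Hypothesis psi_supp : forall x, psi x != 0 -> forall i, `|x ord0 i| < A.
Hypothesis A_gt0 : 0 < A.
Hypothesis L_large : 2 * A + 1 <= L%:R.
Hypothesis c_ge0 : forall nu, 0 <= c nu.

Local Notation f := (atom_sum psi L c).
Local Notation atom := (atom psi L).

(* An increment of f at scale 2^(-nu) that moves the nu-th atom off its own support. *)
Definition axis_step (nu : nat) : 'rV[R]_n.+1 := (L%:R / 2 ^+ nu) *: delta_mx ord0 ord0.

Lemma enorm_axis_step nu : enorm (axis_step nu) = L%:R / 2 ^+ nu.
Proof.
have h : 0 <= L%:R / 2 ^+ nu :> R by rewrite divr_ge0 // exprn_ge0.
rewrite /enorm (bigD1 ord0) //= big1 ?addr0.
  by rewrite !mxE !eqxx mulr1 sqrtr_sqr ger0_norm.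
move=> i /negPf ni; rewrite !mxE ni andbF mulr0 expr0n //.
Qed.

(** The shift [j * L / 2 ^+ nu] exceeds the width [2 * A / 2 ^+ nu] of the support of [atom nu], so
    it leaves that support. It is also at most 1, too short to cross the gap [L - 2 * A] to another
    one. *)
Lemma atom_step_eq0 nu mu j M x : (0 < j <= M)%N -> (M * L <= 2 ^ nu)%N ->
  atom nu x != 0 -> atom mu (x + j%:R *: axis_step nu) = 0.
Proof.
move=> /andP[j0 jM] ML hx; apply/eqP; apply: contraT => hy.
have e0 : 0 < 2 ^+ nu :> R by rewrite exprn_gt0.
have sE : (x + j%:R *: axis_step nu) ord0 ord0 = x ord0 ord0 + j%:R * L%:R / 2 ^+ nu.
  by rewrite !mxE !eqxx mulr1 mulrA.
set t := j%:R * L%:R / 2 ^+ nu in sE.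
have t0 : 0 <= t by rewrite divr_ge0 ?mulr_ge0 // ltW.
have t1 : t <= 1.
  rewrite ler_pdivrMr // mul1r -natrM -natrX ler_nat.
  by apply: leq_trans ML; rewrite leq_mul2r jM orbT.
have [emu|ne] := eqVneq mu nu.
  have := atom_supp _ _ _ psi_supp _ _ hx ord0.
  rewrite emu in hy; have := atom_supp _ _ _ psi_supp _ _ hy ord0.
  rewrite sE; set z := atom_center _ _ _ _; set a := A / _.
  have : a + a <= t.
    rewrite /a /t -mulrDl ler_pM2r ?invr_gt0 //.
    apply: (@le_trans _ _ L%:R); first by move: L_large A_gt0; lra.
    by rewrite ler_peMl // ler1n.
  rewrite !ltr_norml => h1 /andP[h2 h3] /andP[h4 h5]; lra.
have := atom_supp0 _ _ _ psi_supp A_gt0 _ _ hx.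
have := atom_supp0 _ _ _ psi_supp A_gt0 _ _ hy.
rewrite sE !ltr_norml => /andP[h1 h2] /andP[h3 h4].
have [lt|lt|/eqP] := ltngtP mu nu; last by rewrite (negPf ne).
- have : ((L * mu)%:R + L%:R <= (L * nu)%:R :> R).
    by rewrite -natrD ler_nat -mulnSr leq_mul2l lt orbT.
  move: L_large A_gt0; lra.
- have : ((L * nu)%:R + L%:R <= (L * mu)%:R :> R).
    by rewrite -natrD ler_nat -mulnSr leq_mul2l lt orbT.
  move: L_large A_gt0; lra.
Qed.

Lemma diffM_atom_sum nu M x : (M * L <= 2 ^ nu)%N -> atom nu x != 0 ->
  Defs.diffM M (axis_step nu) f x = (- 1) ^+ M * (c nu * atom nu x).
Proof.
move=> ML hx; rewrite /Defs.diffM big_ord_recl big1 ?addr0.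
  rewrite subn0 bin0 mulr1 scale0r addr0.
  rewrite (atom_sum_at _ _ _ psi_ge0 c_ge0 nu) // => mu ne.
  exact: (atom_disjoint _ _ _ psi_supp A_gt0 L_large _ _ _ ne hx).
move=> j _.
have z mu : atom mu (x + (lift ord0 j)%:R *: axis_step nu) = 0.
  by apply: (@atom_step_eq0 nu mu _ M) => //=; rewrite /bump /= add1n ltn_ord.
(* Every atom vanishes at the shifted point, so the index [0] is an arbitrary choice. *)
by rewrite (atom_sum_at _ _ _ psi_ge0 c_ge0 0%N) // z !mulr0.
Qed.

(** The norm is bounded below on one cube, the rescaled copy of the cube where [psi >= delta]; there
    the difference is the nu-th piece up to sign. *)
Lemma Lpnorm_diffM_atom_sum (y0 : 'rV[R]_n.+1) (eta delta p : R) nu M :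
  0 < eta -> 0 < delta -> (forall x, cube y0 eta x -> delta <= psi x) -> 1 <= p ->
  (M * L <= 2 ^ nu)%N ->
  ((c nu * delta * ((2 * (eta / 2 ^+ nu)) ^+ n.+1) `^ p^-1)%:E
   <= Lpnorm p (Defs.diffM M (axis_step nu) f))%E.
Proof.
move=> eta0 delta0 hy p1 ML.
have p0 : 0 < p by exact: lt_le_trans p1.
have e0 : 0 < 2 ^+ nu :> R by rewrite exprn_gt0.
have cd0 : 0 <= c nu * delta by rewrite mulr_ge0 // ltW.
have v0 : 0 <= (2 * (eta / 2 ^+ nu)) ^+ n.+1.
  by rewrite exprn_ge0 // mulr_ge0 // divr_ge0 // ltW.
have -> : (c nu * delta * ((2 * (eta / 2 ^+ nu)) ^+ n.+1) `^ p^-1)%:E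
  = poweR ((c nu * delta) `^ p * (2 * (eta / 2 ^+ nu)) ^+ n.+1)%:E p^-1.
  rewrite poweR_EFin powRM ?powR_ge0 // -powRrM mulfV ?gt_eqF // powRr1 //.
apply: poweR_le; first by rewrite invr_ge0 ltW.
  by rewrite lee_fin mulr_ge0 // powR_ge0.
(* The point that the affine map inside [atom nu] sends to [y0]. *)
pose z : 'rV[R]_n.+1 := \row_i (y0 ord0 i / 2 ^+ nu + atom_center L nu ord0 i).
rewrite -(@iint_cube _ _ z) ?powR_ge0 //; last by rewrite divr_ge0 // ltW.
apply: le_iint => x; rewrite lee_fin; first by rewrite mulr_ge0 // powR_ge0.
have [hz|_] := boolP (cube z _ x); last by rewrite mulr0 powR_ge0.
have dx : delta <= atom nu x.
  apply: hy; apply/forallP => i; rewrite atom_arg.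
  have := forallP hz i; rewrite mxE ler_pdivlMr //.
  rewrite -[X in _ * X <= _](gtr0_norm e0) -normrM; congr (`|_| <= _).
  by rewrite mulrBl mulrDl divfK ?gt_eqF //; ring.
have ax0 : atom nu x != 0 by rewrite gt_eqF // (lt_le_trans delta0).
rewrite mulr1 diffM_atom_sum // normrM normrX normrN1 expr1n mul1r.
rewrite ger0_norm; last by rewrite mulr_ge0 // atom_ge0.
apply: ge0_ler_powR; rewrite ?nnegrE ?(ltW p0) ?mulr_ge0 ?atom_ge0 ?(ltW delta0) //.
by rewrite ler_wpM2l.
Qed.

End AtomDifferences.

(** * Construction of the counterexample *)

Lemma smooth_continuous {R : realType} {N : nat} (g : 'rV[R]_N -> R) :
  smooth g -> continuous g.
Proof. by move=> sg x; apply: differentiable_continuous; exact: (sg [::] x). Qed.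

Lemma le_enorm {R : realType} {N : nat} (x : 'rV[R]_N) i : `|x ord0 i| <= enorm x.
Proof.
rewrite -sqrtr_sqr; apply: ler_wsqrtr; rewrite (bigD1 i) //= lerDl.
by apply: sumr_ge0 => j _; exact: sqr_ge0.
Qed.

(** * Consequences of the partition of unity *)

Section PartitionOfUnity.
Context {R : realType} {N : nat}.
Variables (psi : 'rV[R]_N -> R) (r0 : R).
Hypothesis ok : psi_ok psi r0.

Lemma psi_ok_le1 x : psi x <= 1.
Proof.
have [psi0 [_ [_ sum1]]] := ok.
rewrite -lee_fin -(sum1 x).
have := @esum_set1 R 'rV[int]_N (0 : 'rV[int]_N)
  (fun k => (psi (x - map_mx (fun z : int => z%:~R) k))%:E).
rewrite (_ : map_mx _ 0 = 0) ?subr0; last by apply/matrixP => i j; rewrite !mxE.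
move=> <-; last by rewrite lee_fin.
rewrite esum_mkcond; apply: le_esum => k _; case: ifP => // _.
by rewrite lee_fin.
Qed.

Lemma psi_ok_supp x : psi x != 0 -> forall i, `|x ord0 i| < 2 `^ r0.
Proof.
have [_ [_ [supp _]]] := ok.
move=> hx i; apply: le_lt_trans (le_enorm x i) _.
by apply: supp; apply: subset_closure.
Qed.

(** Translates of [psi] sum to 1 at the origin, so [psi] is positive somewhere; continuity keeps it
    above half that value nearby. *)
Lemma psi_ok_cube : exists y0 : 'rV[R]_N, exists eta delta : R,
  [/\ 0 < eta, 0 < delta & forall x, cube y0 eta x -> delta <= psi x].
Proof.
have [psi0 [sm [_ sum1]]] := ok.
have [y0 py0] : exists y0, 0 < psi y0.
  apply: contrapT => h; have := sum1 0; rewrite esum1; first by move=> /esym/eqP; rewrite onee_eq0.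
  move=> k _; congr EFin; apply/eqP; rewrite eq_le psi0 andbT leNgt; apply/negP => pk.
  by apply: h; eexists; exact: pk.
have d0 : 0 < psi y0 / 2 by rewrite divr_gt0.
have : \forall x \near y0, psi y0 / 2 < psi x.
  have /cvgrPdist_lt /(_ _ d0) := smooth_continuous _ sm y0.
  apply: filterS => x; rewrite ltr_norml => /andP[_]; lra.
(* Half the radius, since the cube is closed and the ball open. *)
move=> /nbhs_ballP[e /= e0 he]; exists y0, (e / 2), (psi y0 / 2).
split => //; first by rewrite divr_gt0.
move=> x /forallP hx; apply/ltW/he; split => // i j; rewrite [i]ord1 /ball /= distrC.
by apply: le_lt_trans (hx j) _; rewrite gtr_pMr // invf_lt1 // ltr1n.
Qed.

End PartitionOfUnity.

Section Pow2.
Context {R : realType}.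

Lemma pow2D (a b : R) : 2 `^ (a + b) = 2 `^ a * 2 `^ b.
Proof. by rewrite powRD // pnatr_eq0 implybT. Qed.

Lemma pow2X (a : R) k : (2 `^ a) ^+ k = 2 `^ (k%:R * a).
Proof. by rewrite mulrC powRrM powR_mulrn // powR_ge0. Qed.

Lemma pow2VX nu N : (2 ^- nu) ^+ N = 2 `^ (- (nu%:R * N%:R)) :> R.
Proof. by rewrite powRN -natrM powR_mulrn // exprM exprVn. Qed.

Lemma pow2N_lt1 (a : R) : 0 < a -> 0 <= 2 `^ (- a) < 1.
Proof.
move=> a0; rewrite powR_ge0 /= powRN invf_lt1 ?powR_gt0 //.
by rewrite /powR pnatr_eq0 /= expR_gt1 mulr_gt0 // ln_gt0 // ltr1n.
Qed.

End Pow2.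

(** * Estimates for the lacunary coefficients *)

Section LacunaryCoefficients.
Context {R : realType}.
Variables (n : nat) (s p q : R).
Hypotheses (s0 : 0 < s) (p1 : 1 <= p) (q1 : 1 <= q).

Definition lacunary (nu : nat) : R :=
  (pow2_weight nu)%:R `^ q^-1 * 2 `^ (- (nu%:R * (s - n.+1%:R / p))).

Let p0 : 0 < p. Proof. exact: lt_le_trans p1. Qed.
Let q0 : 0 < q. Proof. exact: lt_le_trans q1. Qed.

Lemma lacunary_ge0 nu : 0 <= lacunary nu.
Proof. by rewrite mulr_ge0 // powR_ge0. Qed.

(** The q-th power of the left side is one term of the series in [sum_pow2_weight_geometric]. Half
    of the decay [s] absorbs the weight, leaving the other half for geometric convergence. *)
Lemma pow2_weight_growth : exists2 K : R, 0 <= K &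
  forall nu, (pow2_weight nu)%:R `^ q^-1 * 2 `^ (- (nu%:R * (s / 2))) <= K.
Proof.
pose y : R := 2 `^ (- (s / 2 * q)).
have y01 : 0 <= y < 1 by apply: pow2N_lt1; rewrite mulr_gt0 // divr_gt0.
exists ((2 / (1 - y)) `^ q^-1) => [|nu]; first exact: powR_ge0.
have -> : 2 `^ (- (nu%:R * (s / 2))) = (y ^+ nu) `^ q^-1.
  by rewrite pow2X -powRrM; congr (_ `^ _); field; exact: lt0r_neq0.
have /andP[y0 y1] := y01.
rewrite -powRM ?exprn_ge0 //; apply: ge0_ler_powR.
- by rewrite invr_ge0 ltW.
- by rewrite nnegrE mulr_ge0 // exprn_ge0.
- by rewrite nnegrE divr_ge0 // subr_ge0 ltW.
apply: le_trans (sum_pow2_weight_geometric y nu.+1 y01).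
rewrite big_ord_recr /= lerDr; apply: sumr_ge0 => i _.
by rewrite mulr_ge0 // exprn_ge0.
Qed.

(** The exponent contains a further [- nu N (1 - 1/p)], which is nonpositive because [p >= 1] and is
    dropped. *)
Lemma lacunary_L1 (K : R) :
  (forall nu, (pow2_weight nu)%:R `^ q^-1 * 2 `^ (- (nu%:R * (s / 2))) <= K) ->
  forall nu, lacunary nu * (2 ^- nu) ^+ n.+1 <= K * (2 `^ (- (s / 2))) ^+ nu.
Proof.
move=> hK nu; rewrite pow2VX pow2X /lacunary -mulrA -pow2D.
set N : R := n.+1%:R.
have -> : - (nu%:R * (s - N / p)) + - (nu%:R * N) =
  - (nu%:R * (s / 2)) + (- (nu%:R * (s / 2)) - nu%:R * (N * (1 - p^-1)))
  by field; exact: lt0r_neq0.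
rewrite pow2D mulrA; apply: ler_pM; rewrite ?mulr_ge0 ?powR_ge0 //.
apply: ler_powR; first by rewrite ler1n.
rewrite mulrN gerBl mulr_ge0 // mulr_ge0 // subr_ge0 invf_le1 //.
Qed.

Lemma lacunary_Lp (K : R) : 0 <= K ->
  (forall nu, (pow2_weight nu)%:R `^ q^-1 * 2 `^ (- (nu%:R * (s / 2))) <= K) ->
  forall nu, lacunary nu `^ p * (2 ^- nu) ^+ n.+1
    <= K `^ p * (2 `^ (- (s / 2 * p))) ^+ nu.
Proof.
move=> K0 hK nu; rewrite pow2VX pow2X.
set N : R := n.+1%:R.
have -> : 2 `^ (- (nu%:R * N)) = (2 `^ (- (nu%:R * N / p))) `^ p.
  by rewrite -powRrM mulNr divfK // gt_eqF.
have -> : 2 `^ (nu%:R * - (s / 2 * p)) = (2 `^ (- (nu%:R * (s / 2)))) `^ p.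
  by rewrite -powRrM; congr (_ `^ _); ring.
rewrite -!powRM ?powR_ge0 ?lacunary_ge0 //.
apply: ge0_ler_powR; rewrite ?nnegrE ?(ltW p0) ?mulr_ge0 ?powR_ge0 ?lacunary_ge0 //.
rewrite /lacunary -mulrA -pow2D.
have -> : - (nu%:R * (s - N / p)) + - (nu%:R * N / p) =
  - (nu%:R * (s / 2)) + - (nu%:R * (s / 2)) by field; rewrite gt_eqF.
by rewrite pow2D mulrA ler_wpM2r // powR_ge0.
Qed.

(** The terms in [N/p] cancel, leaving a geometric ratio that tends to 1 as [r] tends to [s]. *)
Lemma lacunary_quark_coef (r : R) nu :
  `|lacunary nu * 2 `^ (nu%:R * (r - n.+1%:R / p))| `^ q
  = (pow2_weight nu)%:R * (2 `^ (- ((s - r) * q))) ^+ nu.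
Proof.
rewrite ger0_norm; last by rewrite mulr_ge0 ?lacunary_ge0 // powR_ge0.
rewrite /lacunary -mulrA -pow2D powRM ?powR_ge0 // -!powRrM mulVf ?gt_eqF //.
by rewrite powRr1 // pow2X; congr (_ * 2 `^ _); ring.
Qed.

(** [powR2N_gap] at [t = (s - r) * q] bounds [(s - r) / (1 - y)]; replacing [s - r] by [s] in the
    numerator makes the bound uniform in [r]. *)
Lemma lacunary_gap_bound (r : R) : 0 < r < s ->
  (s - r) `^ q^-1 * (2 / (1 - 2 `^ (- ((s - r) * q)))) `^ q^-1
  <= (2 * (1 + s * q * ln 2) / (q * ln 2)) `^ q^-1.
Proof.
move=> /andP[r0 rs]; have sr : 0 < s - r by rewrite subr_gt0.
have l0 : 0 < ln 2 :> R by rewrite ln_gt0 // ltr1n.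
have t0 : 0 < (s - r) * q by rewrite mulr_gt0.
have /andP[y0 y1] := pow2N_lt1 _ t0; have gap := powR2N_gap _ t0.
set y := 2 `^ _ in y0 y1 gap *.
have d0 : 0 < 1 - y by rewrite subr_gt0.
rewrite -powRM ?(ltW sr) ?divr_ge0 ?(ltW d0) //.
apply: ge0_ler_powR.
- by rewrite invr_ge0 ltW.
- by rewrite nnegrE mulr_ge0 ?(ltW sr) // divr_ge0 // ltW.
- rewrite nnegrE divr_ge0 ?mulr_ge0 ?addr_ge0 ?mulr_ge0 ?(ltW s0) ?(ltW q0) ?(ltW l0) //.
rewrite mulrA ler_pdivrMr // mulrAC ler_pdivlMr ?mulr_gt0 //.
have : (1 - y) * (1 + (s - r) * q * ln 2) <= (1 - y) * (1 + s * q * ln 2).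
  rewrite ler_pM2l // lerD2l ler_pM2r // ler_pM2r //; lra.
move: gap; set G := (1 - y) * _; set H := (1 - y) * _ => gap GH.
have -> : (s - r) * 2 * (q * ln 2) = 2 * ((s - r) * q * ln 2) by ring.
have -> : 2 * (1 + s * q * ln 2) * (1 - y) = 2 * H by rewrite /H; ring.
lra.
Qed.

(** Powers of [2 ^ nu] cancel: exponent [s] from the increment, [-(s - N/p)] from the coefficient
    and [-N/p] from the volume. Only the unbounded weight remains. *)
Lemma lacunary_smoothness (L : nat) (eta delta : R) nu : (0 < L)%N -> 0 < eta ->
  (L%:R / 2 ^+ nu) `^ (- s)
    * (lacunary nu * delta * ((2 * (eta / 2 ^+ nu)) ^+ n.+1) `^ p^-1)
  = L%:R `^ (- s) * delta * ((2 * eta) ^+ n.+1) `^ p^-1 * (pow2_weight nu)%:R `^ q^-1.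
Proof.
move=> L0 eta0; rewrite /lacunary.
have -> : (2 ^+ nu : R)^-1 = 2 `^ (- nu%:R) by rewrite powRN powR_mulrn.
rewrite powRM ?powR_ge0 // -powRrM [2 * (eta * _)]mulrA exprMn.
rewrite powRM ?exprn_ge0 ?powR_ge0 ?mulr_ge0 ?(ltW eta0) //.
rewrite pow2X -[X in _ * (_ * (_ * X))]powRrM.
set N : R := n.+1%:R; set W := _%:R `^ q^-1; set E := _ `^ p^-1; set l := L%:R `^ _.
have e : 2 `^ (- nu%:R * - s) * 2 `^ (- (nu%:R * (s - N / p))) * 2 `^ (N * - nu%:R / p) = 1.
  by rewrite -!pow2D (_ : _ + _ = 0) ?powRr0 //; field; rewrite gt_eqF.
move: e; set a := 2 `^ _; set b := 2 `^ _; set d := 2 `^ _ => e.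
transitivity (l * delta * E * W * (a * b * d)); last by rewrite e mulr1.
by ring.
Qed.

End LacunaryCoefficients.

(** * The counterexample and its three properties *)

Theorem theorem2p14 (R : realType) (N : nat) (psi : 'rV[R]_N -> R) (r0 rho : R)
    (s p q : R) :
  (1 <= N)%N -> 0 <= r0 -> psi_ok psi r0 -> r0 < rho ->
  0 < s -> 1 <= p -> 1 <= q ->
  exists f : 'rV[R]_N -> R,
    inLp p f /\
    (ereal_sup [set ((s - r) `^ q^-1)%:E * besov_qnorm psi rho r p q f
                | r in [set r : R | (0 < r < s)%R]] < +oo)%E /\
    ~ inBinf s p f.
Proof.
case: N psi => [//|n] psi _ _ ok _ s0 p1 q1.
have psi0 x : 0 <= psi x by case: ok.
have psi1 := psi_ok_le1 _ _ ok.
have psiA := psi_ok_supp _ _ ok.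
have psiC : continuous psi by case: ok => _ [/smooth_continuous].
have [y0 [eta [delta [eta0 delta0 psiD]]]] := psi_ok_cube _ _ ok.
have A0 : 0 < 2 `^ r0 by exact: powR_gt0.
pose L := (Num.truncn (2 * 2 `^ r0 + 1)).+1.
have LA : 2 * 2 `^ r0 + 1 <= L%:R by apply/ltW; exact: truncnS_gt.
pose c := lacunary n s p q.
have c0 nu : 0 <= c nu by exact: lacunary_ge0.
have [K K0 hK] := pow2_weight_growth _ _ s0 q1.
have s2 : 0 < s / 2 by rewrite divr_gt0.
have p0 : 0 < p by exact: lt_le_trans p1.
have q0 : 0 < q by exact: lt_le_trans q1.
exists (atom_sum psi L c); split; last split.
- apply: (atom_sum_inLp _ _ _ _ psi0 psi1 psiA psiC A0 LA c0 _ (K `^ p)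
    (2 `^ (- (s / 2 * p)))) => //.
  + by apply: pow2N_lt1; rewrite mulr_gt0.
  + exact: powR_ge0.
  + exact: lacunary_Lp.
- apply: (@le_lt_trans _ _ ((2 * (1 + s * q * ln 2) / (q * ln 2)) `^ q^-1)%:E); last exact: ltry.
  apply: ge_ereal_sup => _ [r /= rs <-].
  have /andP[r0' r1] := rs.
  apply: (@le_trans _ _ (((s - r) `^ q^-1)%:E
      * ((2 / (1 - 2 `^ (- ((s - r) * q)))) `^ q^-1)%:E)%E); last first.
    by rewrite -EFinM lee_fin lacunary_gap_bound.
  apply: lee_wpmul2l; first by rewrite lee_fin powR_ge0.
  (* The quarkonial norm is an infimum, so one explicit representation bounds it. *)
  apply: (@le_trans _ _ (coef_norm rho p q (atom_coefs L c r p))).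
    apply: ereal_inf_lbound; exists (atom_coefs L c r p) => //=.
    apply: (represents_atom_sum _ _ _ _ psi0 psi1 psiA psiC A0 LA c0 r p K
      (2 `^ (- (s / 2)))) => //; first exact: pow2N_lt1.
    exact: lacunary_L1.
  apply: coef_norm_atom_coefs => //.
  have y01 : 0 <= 2 `^ (- ((s - r) * q)) < 1.
    by apply: pow2N_lt1; rewrite mulr_gt0 // subr_gt0.
  apply: nneseries_fin_le => [nu|m]; first exact: powR_ge0.
  under eq_bigr do rewrite lacunary_quark_coef //.
  exact: sum_pow2_weight_geometric.
move=> [_ [M [sM]]]; set S := ereal_sup _ => Sfin.
pose kappa := L%:R `^ (- s) * delta * ((2 * eta) ^+ n.+1) `^ p^-1.
have kappa0 : 0 < kappa.
  by rewrite !mulr_gt0 // powR_gt0 // exprn_gt0 // mulr_gt0.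
(* Level [2 ^ k] is used, where the weight is [2 ^ k >= k]; the condition on [k] makes the increment
   short enough for the given order [M]. *)
have lower k : (M * L <= k)%N -> ((kappa * k%:R `^ q^-1)%:E <= S)%E.
  move=> Mk.
  have k2 : (k <= 2 ^ k)%N by apply/ltnW; rewrite ltn_expl.
  apply: (@le_trans _ _ (kappa * ((2 ^ k)%N%:R) `^ q^-1)%:E).
    rewrite lee_fin ler_pM2l //; apply: ge0_ler_powR; rewrite ?nnegrE ?invr_ge0 ?(ltW q0) //.
    by rewrite ler_nat.
  have ML : (M * L <= 2 ^ (2 ^ k))%N.
    by apply: (leq_trans Mk); apply: (leq_trans k2); apply/ltnW; rewrite ltn_expl.
  pose h : 'rV[R]_n.+1 := axis_step L (2 ^ k).
  have hn : enorm h = L%:R / 2 ^+ (2 ^ k) by exact: enorm_axis_step.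
  apply: (@le_trans _ _ ((enorm h `^ (- s))%:E * Lpnorm p (Defs.diffM M h (atom_sum psi L c)))%E).
    rewrite hn /kappa -{1}(pow2_weightX k) -(lacunary_smoothness _ _ _ _ p1) // EFinM.
    apply: lee_wpmul2l; first by rewrite lee_fin powR_ge0.
    exact: (Lpnorm_diffM_atom_sum _ _ _ _ psi0 psiA A0 LA c0 y0).
  apply: ereal_sup_ubound; exists h => //=.
  apply: contraTN isT => /eqP h0; move: hn; rewrite h0 /enorm big1 ?sqrtr0.
    by move=> /esym/eqP; rewrite gt_eqF // divr_gt0 // exprn_gt0.
  by move=> i _; rewrite mxE expr0n.
(* [Sfin] rules out plus infinity and [lower] rules out minus infinity. *)
have [T hT] : exists T, S = T%:E.
  move: Sfin (lower (M * L)%N (leqnn _)); case: S {lower} => [T||] //.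
  by move=> _ _; exists T.
(* Chosen so that [k] exceeds the q-th power of [|T| / kappa], making the lower bound larger than
   [T]. *)
pose k := (M * L + (Num.truncn ((`|T| / kappa) `^ q)).+1)%N.
have := lower k (leq_addr _ _); rewrite hT lee_fin; apply/negP; rewrite -ltNge.
apply: (le_lt_trans (ler_norm T)); rewrite mulrC -ltr_pdivrMr //.
have x0 : 0 <= `|T| / kappa by rewrite divr_ge0 // ltW.
have -> : `|T| / kappa = ((`|T| / kappa) `^ q) `^ q^-1.
  by rewrite -powRrM mulfV ?lt0r_neq0 // powRr1.
apply: gt0_ltr_powR; rewrite ?nnegrE ?invr_gt0 ?powR_ge0 //.
apply: lt_le_trans (truncnS_gt _) _; rewrite ler_nat; exact: leq_addl.
Qed.
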